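(* Let $E$ be a sharp edge of $\partial M$ with underlying curve $e:d\to\mathbb{R}^3$, and let $p=(s',t')\in\mathcal F^E$. The surface $C^E$, parametrized by $\sigma^E:\mathcal F^E\to\mathbb{R}^3$, $\sigma^E(s,t)=A(t)\cdot e(s)+b(t)$, has a singularity at the point $\sigma^E(p)$ if and only if the velocity $\gamma_{e(s')}'(t')$ is tangent to the (moved) edge at $\sigma^E(p)$, i.e. if and only if $\gamma_{e(s')}'(t')$ and $A(t')\cdot\frac{de}{ds}(s')$ are linearly dependent.
   Context: $M\subset\mathbb{R}^3$ is a compact solid whose boundary $\partial M$ is a finite union of smooth faces meeting along smooth edges and vertices. $E$ is a sharp edge, i.e. the common edge of two smooth faces $F,F'$ whose unit outward normals $N_1(s),N_2(s)$ at $e(s)$ are linearly independent. $E=e(d)$, where $d=[s_0,s_1]$ and $e:d\to\mathbb{R}^3$ is smooth with $\frac{de}{ds}\neq 0$. The trajectory is $h:I\to(SO(3),\mathbb{R}^3)$, $h(t)=(A(t),b(t))$, of class $C^k$, $k\ge 2$, on a closed interval $I=[t_0,t_1]$. For a point $x$, $\gamma_x(t)=A(t)x+b(t)$ and $\gamma_x'(t)=A'(t)x+b'(t)$. For $\alpha\in[0,1]$ let $N_{e(s)}(\alpha)=\dfrac{\alpha N_1(s)+(1-\alpha)N_2(s)}{\|\alpha N_1(s)+(1-\alpha)N_2(s)\|}$ and $f^E(s,\alpha,t)=\langle A(t)N_{e(s)}(\alpha),\gamma_{e(s)}'(t)\rangle$. The funnel of $E$ is $\mathcal F^E=\{(s,t)\in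 d\times I: f^E(s,\alpha,t)=0\text{ for some }\alpha\in[0,1]\}$. $C^E=\sigma^E(\mathcal F^E)$. A parametric surface $S$ is said to have a singularity at the point $S(u_0,v_0)$ if $S$ fails to be an immersion at $(u_0,v_0)$, i.e. the Jacobian $J_S(u_0,v_0)$ has rank less than $2$. Here the Jacobian of $\sigma^E$ is that of the map $(s,t)\mapsto A(t)e(s)+b(t)$ on $d\times I$ (one-sided derivatives at the ends). *)

(* Defs.v *)
From HB Require Import structures.
From mathcomp Require Import all_boot all_order all_algebra.
From mathcomp Require Import all_classical all_reals all_analysis.

Set Implicit Arguments.
Unset Strict Implicit.
Unset Printing Implicit Defensive.

Import Order.TTheory GRing.Theory Num.Theory.
Import numFieldNormedType.Exports.

Local Open Scope classical_set_scope.
Local Open Scope ring_scope.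

(* The library norm on matrices is the sup norm; [norm2] is the Euclidean one. *)
Definition dot3 (R : realType) (u v : 'cV[R]_3) : R := (u^T *m v) 0 0.

Definition norm2 (R : realType) (u : 'cV[R]_3) : R := Num.sqrt (dot3 u u).

(** * Differentiability relative to a subset of the line *)

(* The increment h is restricted to x + h \in D, so these are one-sided
   derivatives at the end points when D is a segment. *)
Definition diff_quotient (R : realType) (V : normedModType R)
    (f : R -> V) (x h : R) : V :=
  h^-1 *: (f (x + h) - f x).

Definition derivable_in (R : realType) (V : normedModType R)
    (D : set R) (f : R -> V) (x : R) : Prop :=
  cvg (diff_quotient f x @ within [set h | D (x + h)] 0^').

Definition deriv_in (R : realType) (V : normedModType R)
    (D : set R) (f : R -> V) (x : R) : V :=
  lim (diff_quotient f x @ within [set h | D (x + h)] 0^').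

Fixpoint Ck_in (R : realType) (V : normedModType R) (k : nat)
    (D : set R) (f : R -> V) : Prop :=
  match k with
  | 0%N => {within D, continuous f}
  | k'.+1 => (forall x, D x -> derivable_in D f x) /\ Ck_in k' D (deriv_in D f)
  end.

Definition smooth_in (R : realType) (V : normedModType R)
    (D : set R) (f : R -> V) : Prop :=
  forall k, Ck_in k D f.

(** * Smooth functions on open subsets of space, regular surfaces *)

Definition partial3 (R : realType) (i : 'I_3) (g : 'cV[R]_3 -> R) :
    'cV[R]_3 -> R :=
  'D_(delta_mx i 0) g.

Definition gradient3 (R : realType) (g : 'cV[R]_3 -> R) (x : 'cV[R]_3) :
    'cV[R]_3 :=
  \col_i partial3 i g x.

Fixpoint Ck_on (R : realType) (k : nat) (W : set 'cV[R]_3)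
    (g : 'cV[R]_3 -> R) : Prop :=
  {within W, continuous g} /\
  match k with
  | 0%N => True
  | k'.+1 => forall i : 'I_3,
      (forall x, W x -> derivable g x (delta_mx i 0)) /\
      Ck_on k' W (partial3 i g)
  end.

Definition local_equation (R : realType) (S W : set 'cV[R]_3)
    (g : 'cV[R]_3 -> R) : Prop :=
  [/\ open W,
      forall k, Ck_on k W g,
      forall y, W y -> gradient3 g y != 0
    & S `&` W = [set y | W y /\ g y = 0]].

Definition regular_surface (R : realType) (S : set 'cV[R]_3) : Prop :=
  forall x, S x -> exists W g, W x /\ local_equation S W g.

Definition unit_normal (R : realType) (S : set 'cV[R]_3) (x n : 'cV[R]_3) :
    Prop :=
  norm2 n = 1 /\
  exists W g, [/\ W x, local_equation S W g & exists c, n = c *: gradient3 g x].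

Definition rel_interior (R : realType) (S F : set 'cV[R]_3) : set 'cV[R]_3 :=
  [set x | S x /\ within S (nbhs x) F].

(** * Solids given by their boundary faces, edges and vertices *)

Record arc (R : realType) := Arc {
  arc_start : R;
  arc_end : R;
  arc_map :> R -> 'cV[R]_3
}.

Definition arc_dom (R : realType) (e : arc R) : set R :=
  `[arc_start e, arc_end e]%classic.

Definition arc_image (R : realType) (e : arc R) : set 'cV[R]_3 :=
  e @` arc_dom e.

Definition regular_arc (R : realType) (e : arc R) : Prop :=
  [/\ arc_start e < arc_end e,
      smooth_in (arc_dom e) e
    & forall s, arc_dom e s -> deriv_in (arc_dom e) e s != 0].

(* [face_surface] is a regular surface without boundary from which the compact
   piece [face_set] is trimmed; it gives tangent planes, hence normals, also at
   the points of the bounding edges. *)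
Record face (R : realType) := Face {
  face_set : set 'cV[R]_3;
  face_surface : set 'cV[R]_3;
  face_normal : 'cV[R]_3 -> 'cV[R]_3
}.

Definition face_interior (R : realType) (F : face R) : set 'cV[R]_3 :=
  rel_interior (face_surface F) (face_set F).

Record brep (R : realType) := Brep {
  body : set 'cV[R]_3;
  nb_faces : nat;
  nb_edges : nat;
  brep_face : 'I_nb_faces -> face R;
  brep_edge : 'I_nb_edges -> arc R;
  brep_vertices : seq 'cV[R]_3
}.

Definition smooth_face (R : realType) (M : brep R) (F : face R) : Prop :=
  [/\ compact (face_set F),
      face_set F `<=` face_surface F,
      regular_surface (face_surface F),
      face_set F `<=` closure (face_interior F)
    & forall x, face_set F x -> ~ face_interior F x ->
        exists j : 'I_(nb_edges M),
          arc_image (brep_edge j) x /\ arc_image (brep_edge j) `<=` face_set F].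

(* Near a point interior to the i-th face and on no other face, M lies on one
   side of the face, which decides the sign of the normal; such points are dense
   in the face, so continuity decides it on the bounding edges as well. *)
Definition outward_normal (R : realType) (M : brep R) (i : 'I_(nb_faces M)) :
    Prop :=
  let F := brep_face i in
  let n := face_normal F in
  [/\ {within face_set F, continuous n},
      forall x, face_set F x -> unit_normal (face_surface F) x (n x)
    & forall x, face_interior F x ->
        (forall j, j != i -> ~ face_set (brep_face j) x) ->
        \forall r \near 0^'+, ~ body M (x + r *: n x) /\ body M (x - r *: n x)].

Definition boundary (R : realType) (X : set 'cV[R]_3) : set 'cV[R]_3 :=
  closure X `\` interior X.

Record is_solid (R : realType) (M : brep R) : Prop := IsSolid {
  solid_compact : compact (body M);
  solid_regclosed : regclosed (body M);
  solid_boundary :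
    boundary (body M) =
    \bigcup_(i in [set: 'I_(nb_faces M)]) face_set (brep_face i);
  solid_faces : forall i : 'I_(nb_faces M), smooth_face M (brep_face i);
  solid_normals : forall i : 'I_(nb_faces M), outward_normal i;
  solid_edges : forall j : 'I_(nb_edges M),
    [/\ regular_arc (brep_edge j),
        arc_image (brep_edge j) `<=` boundary (body M),
        brep_edge j (arc_start (brep_edge j)) \in brep_vertices M
      & brep_edge j (arc_end (brep_edge j)) \in brep_vertices M];
  solid_meet : forall (i i' : 'I_(nb_faces M)) x,
    i != i' -> face_set (brep_face i) x -> face_set (brep_face i') x ->
    x \in brep_vertices M \/
    exists j : 'I_(nb_edges M), arc_image (brep_edge j) x /\
      arc_image (brep_edge j) `<=`
        face_set (brep_face i) `&` face_set (brep_face i')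
}.

Definition sharp_edge (R : realType) (M : brep R) (j : 'I_(nb_edges M))
    (i i' : 'I_(nb_faces M)) : Prop :=
  let e := brep_edge j in
  [/\ i != i',
      arc_image e `<=` face_set (brep_face i) `&` face_set (brep_face i')
    & forall s, arc_dom e s ->
        free [:: face_normal (brep_face i) (e s);
                 face_normal (brep_face i') (e s)]].

(** * Trajectories and the swept edge *)

Definition SO3 (R : realType) : set 'M[R]_3 :=
  [set A | A *m A^T = 1%:M /\ \det A = 1].

Definition trajectory (R : realType) (k : nat) (I : set R)
    (A : R -> 'M[R]_3) (b : R -> 'cV[R]_3) : Prop :=
  [/\ forall t, I t -> SO3 (A t), Ck_in k I A & Ck_in k I b].

Definition velocity (R : realType) (I : set R)
    (A : R -> 'M[R]_3) (b : R -> 'cV[R]_3) (x : 'cV[R]_3) (t : R) :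
    'cV[R]_3 :=
  deriv_in I A t *m x + deriv_in I b t.

Definition cone_normal (R : realType) (N1 N2 : R -> 'cV[R]_3) (s alpha : R) :
    'cV[R]_3 :=
  let v := alpha *: N1 s + (1 - alpha) *: N2 s in (norm2 v)^-1 *: v.

Definition fE (R : realType) (I : set R) (A : R -> 'M[R]_3)
    (b : R -> 'cV[R]_3) (e : arc R) (N1 N2 : R -> 'cV[R]_3)
    (s alpha t : R) : R :=
  dot3 (A t *m cone_normal N1 N2 s alpha) (velocity I A b (e s) t).

Definition funnel (R : realType) (I : set R) (A : R -> 'M[R]_3)
    (b : R -> 'cV[R]_3) (e : arc R) (N1 N2 : R -> 'cV[R]_3) : set (R * R) :=
  [set p | [/\ arc_dom e p.1, I p.2 &
    exists alpha, 0 <= alpha <= 1 /\ fE I A b e N1 N2 p.1 alpha p.2 = 0]].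

Definition sigmaE (R : realType) (A : R -> 'M[R]_3) (b : R -> 'cV[R]_3)
    (e : arc R) (p : R * R) : 'cV[R]_3 :=
  A p.2 *m e p.1 + b p.2.

Definition jacobian_in (R : realType) (d I : set R) (S : R * R -> 'cV[R]_3)
    (p : R * R) : 'M[R]_(3, 1 + 1) :=
  row_mx (deriv_in d (fun s => S (s, p.2)) p.1)
         (deriv_in I (fun t => S (p.1, t)) p.2).

Definition has_singularity (R : realType) (d I : set R)
    (S : R * R -> 'cV[R]_3) (p : R * R) : Prop :=
  (\rank (jacobian_in d I S p) < 2)%N.

(* Main.v *)
Require Import Defs.
From HB Require Import structures.
From mathcomp Require Import all_boot all_order all_algebra.
From mathcomp Require Import all_classical all_reals all_analysis.

Set Implicit Arguments.
Unset Strict Implicit.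
Unset Printing Implicit Defensive.

Import Order.TTheory GRing.Theory Num.Theory.
Import numFieldNormedType.Exports.

Local Open Scope classical_set_scope.
Local Open Scope ring_scope.

(** The singularity criterion is a statement about the two columns of the Jacobian of [sigmaE]. With
    [t] fixed, [A t] is a constant linear map and [b t] cancels in differences, so the [s]-column is
    [A t] applied to the tangent of the edge. With [s] fixed, right multiplication by [e s] is
    linear in the matrix, so the [t]-column is the velocity. Both follow from
    [cvg_diff_quotient_linear] and uniqueness of limits ([deriv_in_segment]). A two-column matrix
    has rank below 2 exactly when its columns are dependent ([rank_row_mx_lt2]). *)

(** Properness is what makes the limits defining one-sided derivatives unique. A nondegenerate
    segment offers arbitrarily small nonzero increments at each of its points: forward before the
    right end, backward at it. *)
Lemma within_dnbhs_segment_proper (R : realType) (a c x : R) :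
  a < c -> `[a, c]%classic x ->
  ProperFilter (within [set h | `[a, c]%classic (x + h)] 0^').
Proof.
move=> ac /=; rewrite in_itv /= => /andP[ax xc].
apply: Build_ProperFilter_ex => P; rewrite /within /=.
rewrite /dnbhs /within /= => /nbhs_ballP[r /= r0 rP].
have [xltc|] := ltP x c.
(* [r / 2] keeps the increment strictly inside the ball, [c - x] keeps [x + h] in the segment. *)
- pose h := Num.min (r / 2) (c - x).
  have h0 : 0 < h by rewrite /h lt_min divr_gt0 //= subr_gt0.
  exists h; apply: rP.
  + rewrite /ball /= sub0r normrN gtr0_norm // /h gt_min.
    by rewrite ltr_pdivrMr // ltr_pMr // ltr1n.
  + by rewrite gt_eqF.
  + rewrite /= in_itv /=; apply/andP; split; first exact: ler_wpDr (ltW h0) ax.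
    by rewrite -lerBrDl /h ge_min lexx orbT.
- move=> cx; have {cx xc ax}xc : x = c by apply/le_anti/andP.
  rewrite {x}xc in rP *.
  pose h := Num.min (r / 2) (c - a).
  have h0 : 0 < h by rewrite /h lt_min divr_gt0 //= subr_gt0.
  exists (- h); apply: rP.
  + rewrite /ball /= sub0r opprK gtr0_norm // /h gt_min.
    by rewrite ltr_pdivrMr // ltr_pMr // ltr1n.
  + by rewrite oppr_eq0 gt_eqF.
  + rewrite /= in_itv /= gerBl (ltW h0) andbT.
    by rewrite lerBrDl -lerBrDr /h ge_min lexx orbT.
Qed.

(** Basic neighbourhoods of a matrix are products of neighbourhoods of its entries, and a filter is
    closed under finite intersections. *)
Lemma cvg_mx_coord (T : Type) (U : topologicalType) (m n : nat)
    (F : set_system T) (FF : Filter F) (f : T -> 'M[U]_(m, n))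
    (l : 'M[U]_(m, n)) :
  (forall i j, f x i j @[x --> F] --> l i j) -> f @ F --> l.
Proof.
move=> fl B [P nP sPB]; rewrite /= /nbhs /=.
apply: (@filterS _ F _ [set x | forall i j, P i j (f x i j)]).
  by move=> x Px; apply: sPB.
apply: filter_forall => i; apply: filter_forall => j.
exact: fl (nP i j).
Qed.

Lemma mulmx_continuous (R : realType) (m n p : nat) (B : 'M[R]_(m, n)) :
  continuous (fun X : 'M[R]_(n, p) => B *m X).
Proof.
move=> X; apply: (@cvg_mx_coord _ _ _ _ _ (nbhs_filter X)) => i j.
rewrite mxE; under eq_fun do rewrite mxE.
apply: cvg_big => [|k _]; first exact: add_continuous.
apply: cvgMl_tmp; exact: coord_continuous.
Qed.

Lemma mulmxr_continuous (R : realType) (m n p : nat) (B : 'M[R]_(n, p)) :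
  continuous (fun X : 'M[R]_(m, n) => X *m B).
Proof.
move=> X; apply: (@cvg_mx_coord _ _ _ _ _ (nbhs_filter X)) => i j.
rewrite mxE; under eq_fun do rewrite mxE.
apply: cvg_big => [|k _]; first exact: add_continuous.
apply: cvgMr_tmp; exact: coord_continuous.
Qed.

Lemma deriv_in_segment (R : realType) (V : normedModType R) (a c x : R)
    (f : R -> V) (l : V) :
  a < c -> `[a, c]%classic x ->
  diff_quotient f x @ within [set h | `[a, c]%classic (x + h)] 0^' --> l ->
  deriv_in `[a, c]%classic f x = l.
Proof.
move=> ac Dx fl; have PF := within_dnbhs_segment_proper ac Dx.
exact: cvg_lim fl.
Qed.

(** A linear map commutes with difference quotients, and its continuity lets it pass to the
    limit. *)
Lemma cvg_diff_quotient_linear (R : realType) (U V : normedModType R)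
    (D : set R) (g : {linear U -> V}) (f : R -> U) (x : R) :
  continuous g -> derivable_in D f x ->
  diff_quotient (g \o f) x @ within [set h | D (x + h)] 0^' -->
    g (deriv_in D f x).
Proof.
move=> cg df.
have -> : diff_quotient (g \o f) x = g \o diff_quotient f x.
  by apply/funext => h; rewrite /diff_quotient /= linearZZ (raddfB g).
exact: (continuous_cvg _ (cg _) df).
Qed.

(** After transposition, rank 2 means that the two rows are free. The list is reversed because the
    velocity, second column of the Jacobian, is listed first in the dependence condition. *)
Lemma rank_row_mx_lt2 (K : fieldType) (n : nat) (u v : 'cV[K]_n) :
  (\rank (row_mx u v) < 2)%N = ~~ free [:: v; u].
Proof.
rewrite ltnNge; congr (~~ _).
rewrite -mxrank_tr tr_row_mx.
have -> : (1 < \rank (col_mx u^T v^T))%N = row_free (col_mx u^T v^T).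
  by rewrite /row_free eqn_leq rank_leq_row.
apply/idP/idP => [fr|fr].
- apply/(@freeP _ _ 2 [tuple v; u]) => k.
  rewrite !big_ord_recl big_ord0 addr0 /= => vu0.
  (* [k ord0] is the coefficient of [v], hence it goes in the second slot of the row. *)
  have /(row_free_inj fr) : row_mx (k (lift ord0 ord0))%:M (k ord0)%:M *m
      col_mx u^T v^T = (0 : 'rV_(1 + 1)) *m col_mx u^T v^T.
    rewrite mul0mx mul_row_col !mul_scalar_mx -!linearZ -linearD /=.
    by rewrite addrC vu0 trmx0.
  rewrite -[0]row_mx0 => /eq_row_mx[/matrixP/(_ 0 0) k1 /matrixP/(_ 0 0) k0].
  move: k0 k1; rewrite !mxE !mulr1n => k0 k1 i.
  by case: (unliftP ord0 i) => [j|] ->; rewrite ?(ord1 j).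
- apply: inj_row_free => w.
  rewrite -[w]hsubmxK mul_row_col [lsubmx w]mx11_scalar [rsubmx w]mx11_scalar.
  rewrite !mul_scalar_mx -!linearZ -linearD /=.
  move=> /(congr1 trmx); rewrite trmxK trmx0.
  set p := lsubmx w 0 0; set q := rsubmx w 0 0 => uv0.
  have /(@freeP _ _ 2 [tuple v; u]) := fr.
  move=> /(_ (fun i => if i == ord0 then q else p)).
  rewrite !big_ord_recl big_ord0 addr0 /= addrC => /(_ uv0) pq.
  have /= -> := pq ord0; have /= -> := pq (lift ord0 ord0).
  by rewrite !raddf0 row_mx0.
Qed.

Theorem lemma15 (R : realType) (M : brep R) (hM : is_solid M)
    (E : 'I_(nb_edges M)) (F F' : 'I_(nb_faces M)) (hE : sharp_edge E F F')
    (k : nat) (hk : (2 <= k)%N) (t0 t1 : R) (ht : t0 < t1)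
    (A : R -> 'M[R]_3) (b : R -> 'cV[R]_3)
    (hh : trajectory k `[t0, t1]%classic A b)
    (p : R * R)
    (hp : funnel `[t0, t1]%classic A b (brep_edge E)
            (fun s => face_normal (brep_face F) (brep_edge E s))
            (fun s => face_normal (brep_face F') (brep_edge E s)) p) :
  has_singularity (arc_dom (brep_edge E)) `[t0, t1]%classic
    (sigmaE A b (brep_edge E)) p
  <->
  ~~ free [:: velocity `[t0, t1]%classic A b (brep_edge E p.1) p.2;
              A p.2 *m deriv_in (arc_dom (brep_edge E)) (brep_edge E) p.1].
Proof.
case: p hp => s t [/= ds It _].
have [[ac smooth_e _] _ _ _] := solid_edges hM E.
have [de _] := smooth_e 1%N.
(* At a positive order, [Ck_in] unfolds to derivability of [A] and [b] on the whole interval. *)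
case: k hk hh => // k' _ [_ [dA _] [db _]].
have Js : deriv_in (arc_dom (brep_edge E))
    (fun s => sigmaE A b (brep_edge E) (s, t)) s =
    A t *m deriv_in (arc_dom (brep_edge E)) (brep_edge E) s.
  apply: (deriv_in_segment ac ds).
  have -> : diff_quotient (fun s => sigmaE A b (brep_edge E) (s, t)) s =
      diff_quotient (mulmx (A t) \o brep_edge E) s.
    apply/funext => h; rewrite /diff_quotient /sigmaE /=.
    by rewrite opprD addrACA subrr addr0.
  apply: (cvg_diff_quotient_linear _ (de s ds)).
  exact: mulmx_continuous.
have Jt : deriv_in `[t0, t1]%classic
    (fun t => sigmaE A b (brep_edge E) (s, t)) t =
    velocity `[t0, t1]%classic A b (brep_edge E s) t.
  apply: (deriv_in_segment ht It).
  (* The quotient splits into a linear image of the motion of [A] and the quotient of [b]; their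
     limits are the two terms of the velocity. *)
  have -> : diff_quotient (fun t => sigmaE A b (brep_edge E) (s, t)) t =
      diff_quotient (mulmxr (brep_edge E s) \o A) t \+ diff_quotient b t.
    apply/funext => h; rewrite /diff_quotient /sigmaE /=.
    by rewrite -scalerDr opprD addrACA.
  apply: cvgD; last exact: db t It.
  apply: (cvg_diff_quotient_linear _ (dA t It)).
  exact: mulmxr_continuous.
by rewrite /has_singularity /jacobian_in /= Js Jt rank_row_mx_lt2.
Qed.
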